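(* For $G=\mathbb{Z}/n_{1}\times\cdots\times\mathbb{Z}/n_{k}\times\mathbb{Z}^{m}$, with $n_1,\dots,n_k$ positive integers, we have $$\mathcal{F}_G=\sum_{d_{1}|n_{1}}\cdots\sum_{d_{k}|n_{k}}\frac{\phi(d_{1})\cdots\phi(d_{k})}{\phi(\operatorname{lcm}(d_{1},\cdots ,d_{k}))},$$ where $\phi$ is Euler's totient function and the sums run over the positive divisors $d_i$ of $n_i$.
   Context: For a group $G$, $G^{fin}$ is the set of finite order elements. For $g\in G^{fin}$ of order $d$, $p_g=\frac{1+g+\cdots+g^{d-1}}{d}\in\mathbb{C}G$ (group operation written multiplicatively). The equivalence relation $\sim_{\mathrm{fin}}$ on $G^{fin}$: $g\sim_{\mathrm{fin}}h$ if and only if there is $\gamma\in G$ with $p_g=\gamma p_h\gamma^{-1}$; equivalently, $g$ and $h$ have the same order and some power $g^a$, $a\in\mathbb{N}$, is conjugate to $h$. $\mathcal{F}_G:=|G^{fin}/_{\sim_{\mathrm{fin}}}|$. *)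

(* Defs.v *)
From HB Require Import structures.
From mathcomp Require Import all_boot all_order all_algebra.
From mathcomp Require Import finmap monalg complex.
From mathcomp Require Import boolp classical_sets cardinality reals.

Set Implicit Arguments.
Unset Strict Implicit.
Unset Printing Implicit Defensive.
Import GRing.Theory Num.Theory.
Local Open Scope classical_set_scope.
Local Open Scope ring_scope.

(* The group algebra C[G] is carried by the vector space {malg R[i][G]} of
   finitely supported functions G -> R[i]; << c *g x >> is c times the basis
   vector x.  The ring structure in monalg requires a monoid of monomials, in
   which 1 is the only invertible element, so the convolution product is
   defined here. *)
Section GroupAlgebra.
Variables (R : realType) (G : groupType).

Definition galg_mul (a b : {malg R[i][G]}) : {malg R[i][G]} :=
  \sum_(x <- msupp a) \sum_(y <- msupp b) << a@_x * b@_y *g (x * y)%g >>.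

Definition finite_order : set G :=
  [set g | exists d : nat, (0 < d)%N && (g ^+ d == 1)%g].

(* The value is 0 if g has infinite order. *)
Definition group_order (g : G) : nat :=
  if pselect (exists d : nat, (0 < d)%N && (g ^+ d == 1)%g) is left gfin
  then ex_minn gfin else 0%N.

Definition avg_idem (g : G) : {malg R[i][G]} :=
  (group_order g)%:R^-1 *: \sum_(j < group_order g) << (g ^+ j)%g >>.

Definition fin_equiv (g h : G) : Prop :=
  exists gamma : G,
    avg_idem g =
      galg_mul (galg_mul << gamma >> (avg_idem h)) << gamma^-1%g >>.

Definition fin_classes : set (set G) :=
  [set [set h : G | finite_order h /\ fin_equiv g h] | g in finite_order].

(* Meaningful only when fin_classes is finite (fset_set sends an infinite set
   to the empty one). *)
Definition num_fin_classes : nat := #|` fset_set fin_classes|.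

End GroupAlgebra.

Arguments finite_order : clear implicits.
Arguments fin_classes : clear implicits.

Section DependentProduct.
Variables (I : finType) (T : I -> groupType).

Definition prod_group : Type := {dffun forall i, T i}.
HB.instance Definition _ := Choice.on prod_group.

Definition prod_one : prod_group :=
  [ffun i => 1%g : T i].
Definition prod_inv (f : prod_group) : prod_group :=
  [ffun i => (f i)^-1%g : T i].
Definition prod_mul (f g : prod_group) : prod_group :=
  [ffun i => (f i * g i)%g : T i].

Lemma prod_mulgA : associative prod_mul.
Proof. by move=> f g h; apply/ffunP => i; rewrite !ffunE mulgA. Qed.
Lemma prod_mul1g : left_id prod_one prod_mul.
Proof. by move=> f; apply/ffunP => i; rewrite !ffunE mul1g. Qed.
Lemma prod_mulg1 : right_id prod_one prod_mul.
Proof. by move=> f; apply/ffunP => i; rewrite !ffunE mulg1. Qed.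
Lemma prod_mulVg : left_inverse prod_one prod_inv prod_mul.
Proof. by move=> f; apply/ffunP => i; rewrite !ffunE mulVg. Qed.
Lemma prod_mulgV : right_inverse prod_one prod_inv prod_mul.
Proof. by move=> f; apply/ffunP => i; rewrite !ffunE mulgV. Qed.

HB.instance Definition _ :=
  isGroup.Build prod_group
    prod_mulgA prod_mul1g prod_mulg1 prod_mulVg prod_mulgV.

End DependentProduct.

(* The additive group of V in multiplicative notation. *)
Section Multiplicative.
Variable V : zmodType.

Definition mul_of_add : Type := V.
HB.instance Definition _ := Choice.on mul_of_add.
HB.instance Definition _ :=
  @isGroup.Build mul_of_add (0 : V) (@GRing.opp V) (@GRing.add V)
    (@addrA V) (@add0r V) (@addr0 V) (@addNr V) (@addrN V).

End Multiplicative.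

(* For n > 0, 'I_n.-1.+1 is Z/n: its zmodType structure is addition mod n. *)
Definition fg_abelian_group (k m : nat) (n : 'I_k -> nat) : groupType :=
  (prod_group (fun i => mul_of_add 'I_(n i).-1.+1)
   * mul_of_add 'rV[int]_m)%type.

(* Main.v *)
Require Import Defs.
From mathcomp Require Import all_boot all_order all_algebra.
From mathcomp Require Import all_fingroup cyclic.
From mathcomp Require Import finmap monalg complex.
From mathcomp Require Import boolp classical_sets cardinality reals.
Import GRing.Theory Num.Theory.
Local Open Scope ring_scope.

(** In an abelian group conjugation is trivial, so two elements of finite order
    are equivalent exactly when their averages p_g coincide.  The average over
    the powers of g is the uniform weight on the cyclic subgroup <[g]>, hence
    determines and is determined by <[g]>: the classes are the finite cyclic
    subgroups (num_fin_classes_cycles).  In Z/n_1 x ... x Z/n_k x Z^m they all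
    lie in the finite factor A = Z/n_1 x ... x Z/n_k, since Z^m is torsion free.

    It remains to count the cyclic subgroups of A.  One of order d has phi(d)
    generators, so giving every x in A the weight 1 / phi(#[x]) counts each of
    them once (card_cycles).  Now group the elements of A by the tuple
    (d_1, ..., d_k) of the orders of their components.  The order of such an x
    is lcm(d_1, ..., d_k) (order_dffun), and when d_i divides n_i for all i
    there are phi(d_1) ... phi(d_k) of them, because a cyclic group of order n
    has phi(d) elements of each order d dividing n (card_order_cyclic). *)

(** * Counting cyclic subgroups of finite groups *)


(** The elements generating a given cyclic subgroup of order d are phi(d) in
    number and each weighs 1 / phi(d), so every cyclic subgroup has total
    weight 1. *)
Lemma card_cycles (gT : finGroupType) :
  #|[set <[x]>%g | x : gT]|%:R = \sum_(x : gT) (totient #[x]%g)%:R^-1 :> rat.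
Proof.
have -> : \sum_(x : gT) (totient #[x]%g)%:R^-1 =
          \sum_(x in [set: gT]) (totient #[x]%g)%:R^-1 :> rat.
  by apply: eq_bigl => x; rewrite inE.
rewrite (partition_big_imset (fun x : gT => <[x]>%g)) /=.
have -> : [set <[x]>%g | x : gT] = [set <[x]>%g | x in [set: gT]].
  apply/setP => C.
  by apply/imsetP/imsetP => -[x _ ->]; exists x; rewrite ?inE.
rewrite -sum1_card natr_sum; apply: eq_bigr => C /imsetP[x _ ->{C}].
rewrite (eq_bigr (fun _ => (totient #[x]%g)%:R^-1)); last first.
  by move=> y /andP[_ /eqP eqyx]; rewrite /order eqyx.
rewrite big_const iter_addr_0 (_ : #|_| = totient #[x]%g); last first.
  rewrite totient_gen; apply: eq_card => y.
  rewrite [RHS]inE /generator [RHS]eq_sym.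
  by rewrite unfold_in /= inE.
rewrite -[LHS]/1 -[RHS]mulr_natl mulfV //.
by rewrite pnatr_eq0 -lt0n totient_gt0 order_gt0.
Qed.

(** A cyclic group has a single subgroup of order d, so the elements of order d
    are the generators of that subgroup. *)
Lemma card_order_cyclic (gT : finGroupType) (G : {group gT}) (d : nat) :
  cyclic G -> (d %| #|G|)%N -> #|[set x in G | #[x]%g == d]| = totient d.
Proof.
move=> cG d_dvd; case/cyclicP: (cG) => a defG.
have oa : #[a]%g = #|G| by rewrite defG.
pose b := (a ^+ (#|G| %/ d))%g.
have ob : #[b]%g = d.
  have q_gt0 : (0 < #|G| %/ d)%N.
    have G_gt0 := cardG_gt0 G.
    by rewrite divn_gt0 ?(dvdn_gt0 G_gt0 d_dvd) ?(dvdn_leq G_gt0 d_dvd).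
  rewrite orderXdiv oa ?dvdn_div //; apply/eqP.
  by rewrite -(eqn_pmul2r q_gt0) divnK ?dvdn_div // mulnC divnK.
have bG : b \in G by rewrite defG mem_cycle.
rewrite -ob totient_gen; apply: eq_card => y; rewrite !inE /generator.
apply/andP/idP => [[yG /eqP oy]|/eqP eqby].
  by rewrite (eq_subG_cyclic cG) ?cycle_subG // -!orderE oy ob.
by rewrite [in #[y]%g]orderE -eqby -cycle_subG -eqby cycle_subG.
Qed.

(** Powers are computed componentwise, so x ^+ j = 1 means that j is a common
    multiple of the orders of the components. *)
Lemma order_dffun (I : finType) (gT : I -> finGroupType)
    (x : {dffun forall i, gT i}) :
  #[x]%g = \big[lcmn/1%N]_i #[x i]%g.
Proof.
have expE (j : nat) (i : I) : (x ^+ j)%g i = (x i ^+ j)%g.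
  elim: j => [|j IH]; first by rewrite !expg0 ffunE.
  by rewrite !expgS ffunE IH.
apply/eqP; rewrite eqn_dvd; apply/andP; split.
  rewrite order_dvdn; apply/eqP/ffunP => i; rewrite expE ffunE; apply/eqP.
  by rewrite -order_dvdn (biglcmn_sup i).
apply/dvdn_biglcmP => i _; rewrite order_dvdn -expE expg_order.
by rewrite ffunE.
Qed.

Lemma foldr_muln_prod (I : finType) (F : I -> nat) :
  foldr muln 1%N [seq F i | i : I] = (\prod_i F i)%N.
Proof. by rewrite foldrE big_map big_enum. Qed.

(** Both sides sum 1 / phi(#[x]); the right-hand side groups the x by the orders
    of their components, which range over the tuples of divisors. *)
Lemma sum_totient_order_Zn (k : nat) (n : 'I_k -> nat)
    (n_gt0 : forall i, (0 < n i)%N) :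
  let gT := {dffun forall i : 'I_k, 'I_(n i).-1.+1} in
  \sum_(x : gT) (totient #[x]%g)%:R^-1 =
  \sum_(d : {dffun forall i : 'I_k, 'I_(n i).+1}
            | [forall i : 'I_k, (d i %| n i)%N])
      (\prod_(i < k) (totient (d i))%:R)
        / (totient (\big[lcmn/1%N]_(i < k) (d i : nat)))%:R :> rat.
Proof.
move=> gT.
have ordle (x : gT) i : (#[x i]%g %| n i)%N.
  have := @order_dvdG _ [set: 'I_(n i).-1.+1]%G (x i) (finset.in_setT _).
  by rewrite cardsT card_ord prednK.
have ordlt (x : gT) i : (#[x i]%g < (n i).+1)%N by rewrite ltnS dvdn_leq.
pose ords (x : gT) : {dffun forall i : 'I_k, 'I_(n i).+1} :=
  [ffun i => Ordinal (ordlt x i)].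
rewrite (partition_big ords
  (fun d => [forall i, (d i %| n i)%N])) /=; last first.
  by move=> x _; apply/forallP => i; rewrite ffunE /=; apply: ordle.
apply: eq_bigr => d /forallP ddvd.
rewrite (eq_bigr
  (fun _ => (totient (\big[lcmn/1%N]_(i < k) (d i : nat)))%:R^-1)); last first.
  move=> x /eqP xd; rewrite order_dffun; congr ((totient _)%:R^-1).
  by apply: eq_bigr => i _; rewrite -xd ffunE.
rewrite big_const iter_addr_0 -[LHS]mulr_natl -natr_prod; congr (_%:R * _).
rewrite -(eq_bigr _
  (fun i _ => card_order_cyclic _ [set: 'I_(n i).-1.+1]%G (d i) _ _)).
  rewrite -foldr_muln_prod -card_family.
  apply: eq_card => x.
  (* The unfolded predicates hide the equality of dependent finite functions. *)
  change ((ords x == d) = (x \in family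
    (fun i => [set y in [set: 'I_(n i).-1.+1]%G | #[y]%g == d i]))).
  apply/eqP/familyP => [<- i|xd].
    by rewrite !inE ffunE /=.
  by apply/ffunP => i; apply/val_inj; have := xd i; rewrite !inE ffunE => /eqP.
- by move=> i; rewrite /= Zp_cycle cycle_cyclic.
by move=> i; rewrite cardsT card_ord prednK.
Qed.

(** * Conjugation in the group algebra *)

Section Algebra.
Variables (R : realType) (G : groupType).
Implicit Types (g : G) (a : {malg R[i][G]}).

Lemma mcoeff_basis_mul g a z :
  (galg_mul << g >> a)@_z = a@_(g^-1 * z)%g.
Proof.
rewrite /galg_mul msuppU oner_eq0 big_seq_fset1 raddf_sum /=.
transitivity (\sum_(y <- msupp a) if y == (g^-1 * z)%g then a@_y else 0).
  apply: eq_bigr => y _; rewrite mcoeffU mcoeffUU mul1r.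
  by rewrite (can2_eq (mulKg g) (mulKVg g)); case: eqP.
case: (boolP ((g^-1 * z)%g \in msupp a)) => [zin|znin].
  rewrite (bigD1_seq (g^-1 * z)%g) ?fset_uniq //= eqxx big1 ?addr0 //.
  by move=> y /negbTE->.
rewrite mcoeff_outdom // big_seq big1 // => y yin.
by case: eqP => // yz; rewrite -yz yin in znin.
Qed.

Lemma mcoeff_mul_basis g a z :
  (galg_mul a << g >>)@_z = a@_(z * g^-1)%g.
Proof.
rewrite /galg_mul msuppU oner_eq0 raddf_sum /=.
transitivity (\sum_(x <- msupp a) if x == (z * g^-1)%g then a@_x else 0).
  apply: eq_bigr => x _; rewrite big_seq_fset1 mcoeffU mcoeffUU mulr1.
  by rewrite (can2_eq (mulgK g) (mulgVK g)); case: eqP.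
case: (boolP ((z * g^-1)%g \in msupp a)) => [zin|znin].
  rewrite (bigD1_seq (z * g^-1)%g) ?fset_uniq //= eqxx big1 ?addr0 //.
  by move=> y /negbTE->.
rewrite mcoeff_outdom // big_seq big1 // => y yin.
by case: eqP => // yz; rewrite -yz yin in znin.
Qed.

(** Conjugation by y shifts coefficients by y^-1 on the left and by y on the
    right; the two shifts cancel when G is abelian. *)
Lemma fin_equivE_commutative : (forall x y : G, x * y = y * x)%g ->
  forall g h, fin_equiv R g h <-> avg_idem R g = avg_idem R h.
Proof.
move=> mulC g h; split=> [[y ->]|eqgh].
  apply/malgP => z; rewrite mcoeff_mul_basis mcoeff_basis_mul.
  by rewrite invgK (mulC z) mulKg.
exists 1%g; rewrite eqgh; apply/malgP => z.
by rewrite mcoeff_mul_basis mcoeff_basis_mul !invg1 mulg1 mul1g.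
Qed.

End Algebra.

(** * Classes of torsion elements and cyclic subgroups *)

(** The torsion elements of G are described through an embedding of a finite
    group A, so that the theory of finite groups applies to A. *)
Section FiniteTorsion.
Variables (R : realType) (G : groupType) (A : finGroupType) (iota : A -> G).
Hypothesis iotaM : {morph iota : x y / (x * y)%g}.
Hypothesis iota_inj : injective iota.
Hypothesis iota_im : forall g, finite_order G g <-> exists x, g = iota x.
Hypothesis mulC : forall x y : G, (x * y = y * x)%g.

Let iota1 : iota 1%g = 1%g.
Proof. by apply: (mulgI (iota 1%g)); rewrite -iotaM !mulg1. Qed.

Let iotaX x j : iota (x ^+ j)%g = (iota x ^+ j)%g.
Proof.
by elim: j => [|j IH]; rewrite ?expg0 ?iota1 // !expgS iotaM IH.
Qed.

Lemma group_order_embed x : group_order (iota x) = #[x]%g.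
Proof.
rewrite /group_order; case: pselect => [fin|[]]; last first.
  by exists #[x]%g; rewrite order_gt0 -iotaX expg_order iota1 eqxx.
case: ex_minnP => d /andP[d_gt0 xd] dmin; apply/eqP.
rewrite eqn_leq dmin; last by rewrite order_gt0 -iotaX expg_order iota1 eqxx.
rewrite dvdn_leq // order_dvdn; apply/eqP/iota_inj.
by rewrite iotaX iota1; apply/eqP.
Qed.

(** Stated for all subsets C, so that the average of g visibly depends on the
    subgroup <[g]> only. *)
Definition avg_set (C : {set A}) : {malg R[i][G]} :=
  #|C|%:R^-1 *: \sum_(y in C) << iota y >>.

(** j |-> x ^+ j is a bijection from the exponents j < #[x] onto <[x]>. *)
Lemma avg_idem_embed x : avg_idem R (iota x) = avg_set <[x]>%g.
Proof.
rewrite /avg_idem group_order_embed /avg_set -orderE; congr (_ *: _).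
(* A discrete logarithm, extended by 0 outside <[x]>. *)
pose dlog y :=
  odflt (Ordinal (order_gt0 x)) [pick j : 'I_#[x]%g | (x ^+ j)%g == y].
rewrite (reindex_onto
  (fun j : 'I_#[x]%g => (x ^+ j)%g) dlog) /= /dlog; last first.
  move=> y /cyclePmin[j jlt ->]; case: pickP => [i /eqP //|/(_ (Ordinal jlt))].
  by rewrite eqxx.
apply: eq_big => [j|j _]; last by rewrite iotaX.
rewrite mem_cycle; case: pickP => [i /= |/(_ j)]; last by rewrite eqxx.
by rewrite (eq_expg_ord _ _ (leqnn _)) => ->.
Qed.

Lemma mcoeff_avg_set C y :
  (avg_set C)@_(iota y) = #|C|%:R^-1 *+ (y \in C).
Proof.
rewrite /avg_set mcoeffZ raddf_sum /= (eq_bigr (fun x => (x == y)%:R)).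
  rewrite -[RHS]mulr_natr; congr (_ * _).
  case: (boolP (y \in C)) => yC.
    by rewrite (bigD1 y) //= eqxx big1 ?addr0 // => x /andP[_ /negbTE->].
  by rewrite big1 // => x xC; case: eqP => // xy; rewrite -xy xC in yC.
by move=> x _; rewrite mcoeffU (inj_eq iota_inj).
Qed.

(** The subgroup <[x]> is recovered as the support of its average. *)
Lemma avg_set_cycle_inj x y :
  avg_set <[x]>%g = avg_set <[y]>%g -> <[x]>%g = <[y]>%g.
Proof.
move=> eqa; apply/setP => z.
have card_neq0 t : #|<[t]>%g|%:R^-1 != 0 :> R[i].
  by rewrite invr_eq0 pnatr_eq0 -lt0n order_gt0.
have memE t : (z \in <[t]>%g) = ((avg_set <[t]>%g)@_(iota z) != 0).
  rewrite mcoeff_avg_set.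
  by case: (_ \in _); rewrite ?mulr1n ?card_neq0 ?mulr0n ?eqxx.
by rewrite !memE eqa.
Qed.

Let cycles := [fset C in enum [set <[x]>%g | x : A]]%fset.

Let class_of (C : {set A}) : set G :=
  [set g | exists2 y, g = iota y & <[y]>%g = C].

Lemma fin_classesE :
  fin_classes R G = [set class_of C | C in [set` cycles]]%classic.
Proof.
have classE x :
    [set h : G | finite_order G h /\ fin_equiv R (iota x) h]%classic =
    class_of <[x]>%g.
  apply/seteqP; split=> h /=.
    case=> /iota_im[y ->] /(fin_equivE_commutative R G mulC).
    by rewrite !avg_idem_embed => /avg_set_cycle_inj xy; exists y.
  case=> y -> yx; split; first by apply/iota_im; exists y.
  by apply/(fin_equivE_commutative R G mulC); rewrite !avg_idem_embed yx.
apply/seteqP; split=> E /=.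
  case=> g /iota_im[x ->] <-; exists <[x]>%g; last by rewrite classE.
  by rewrite /= /cycles inE /= mem_enum; apply: imset_f.
case=> C; rewrite /= /cycles inE /= mem_enum => /imsetP[x _ ->] <-.
by exists (iota x); rewrite ?classE //; apply/iota_im; exists x.
Qed.

Lemma finite_fin_classes : finite_set (fin_classes R G).
Proof. by rewrite fin_classesE; apply: finite_image; apply: finite_fset. Qed.

(** Distinct cyclic subgroups give distinct classes, as a class contains the
    generators of its subgroup. *)
Lemma num_fin_classes_cycles :
  num_fin_classes R G = #|[set <[x]>%g | x : A]|.
Proof.
rewrite /num_fin_classes fin_classesE fset_set_image; last exact: finite_fset.
rewrite set_fsetK card_in_imfset /=.
  by rewrite /cycles card_fseq undup_id ?enum_uniq // -cardE.
move=> C D; rewrite !inE /= !mem_enum => /imsetP[x _ ->] /imsetP[y _ ->] eqE.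
have : class_of <[x]>%g (iota x) by exists x.
by rewrite eqE => -[z /iota_inj <-].
Qed.

End FiniteTorsion.

(** * The torsion subgroup of a finitely generated abelian group *)

Section Embedding.
Variables (k m : nat) (n : 'I_k -> nat).
Let A := {dffun forall i : 'I_k, 'I_(n i).-1.+1}.

(** The finite factor is a finGroupType on the domain side and a prod_group on
    the codomain side; both carriers and both group laws are convertible, so the
    embedding is the identity there. *)
Definition torsion_embed (x : A) : fg_abelian_group m n :=
  (x : prod_group (fun i => mul_of_add 'I_(n i).-1.+1), 0 : 'rV[int]_m).

Lemma torsion_embedM : {morph torsion_embed : x y / (x * y)%g}.
Proof.
by move=> x y; apply: injective_projections => //=; rewrite -[LHS]addr0.
Qed.

Lemma torsion_embed_inj : injective torsion_embed.
Proof. by move=> x y []. Qed.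

Lemma fg_abelian_mulC (x y : fg_abelian_group m n) : (x * y = y * x)%g.
Proof.
case: x y => [f v] [g w]; apply: injective_projections; last exact: addrC.
by apply/ffunP => i; rewrite !ffunE; apply: addrC.
Qed.

Lemma torsion_embedX x j : torsion_embed (x ^+ j)%g = (torsion_embed x ^+ j)%g.
Proof.
by elim: j => [|j IH]; rewrite ?expg0 // !expgS torsion_embedM IH.
Qed.

(** A lattice vector v with v *+ d = 0 for some d > 0 vanishes, so the torsion
    elements are exactly those of the finite factor. *)
Lemma finite_order_fg_abelian g :
  finite_order (fg_abelian_group m n) g <-> exists x, g = torsion_embed x.
Proof.
split=> [[d /andP[d_gt0 /eqP]]|[x ->]]; last first.
  by exists #[x]%g; rewrite order_gt0 -torsion_embedX expg_order eqxx.
case: g => f v gd; exists f; congr pair.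
have expE (j : nat) :
    ((f, v : mul_of_add 'rV[int]_m) ^+ j : fg_abelian_group m n)%g.2 =
    (v : 'rV[int]_m) *+ j.
  by elim: j => [|j IH]; rewrite ?expg0 ?mulr0n // expgS mulrS -IH.
have := expE d; rewrite gd => /matrixP v0; apply/matrixP => i j.
have := v0 i j; rewrite mulmxnE mxE => /esym/eqP.
by rewrite mulrn_eq0 -[d == _]negbK -lt0n d_gt0 /= => /eqP.
Qed.

End Embedding.

(** * The formula *)

Theorem corollary5p10 (R : realType) (k m : nat) (n : 'I_k -> nat)
    (n_gt0 : forall i : 'I_k, (0 < n i)%N) :
  let G := fg_abelian_group m n in
  finite_set (fin_classes R G) /\
  (num_fin_classes R G)%:R =
    \sum_(d : {dffun forall i : 'I_k, 'I_(n i).+1}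
            | [forall i : 'I_k, (d i %| n i)%N])
      (\prod_(i < k) (totient (d i))%:R)
        / (totient (\big[lcmn/1%N]_(i < k) (d i : nat)))%:R :> rat.
Proof.
have iotaM := @torsion_embedM k m n; have iota_inj := @torsion_embed_inj k m n.
have iota_im := @finite_order_fg_abelian k m n.
have mulC := @fg_abelian_mulC k m n.
split; first exact: (finite_fin_classes R _ _ _ iotaM iota_inj iota_im mulC).
rewrite (num_fin_classes_cycles R _ _ _ iotaM iota_inj iota_im mulC).
by rewrite card_cycles sum_totient_order_Zn.
Qed.
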